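(* Let $\alpha\neq -1,-2,\ldots$ be a real number. Let $\mathcal F=(F_1,F_2)$ be a pair of finite sets of positive integers with $F_2\neq\emptyset$, let $k_2=|F_2|$, $k=|F_1|+|F_2|$, let $f_{k_2}^2=\max F_2$, and let $\mathcal F'=(F_1,F_2\setminus\{f_{k_2}^2\})$. Define the first order differential operators ($\partial=d/dx$) $$A_{\mathcal F}=-\frac{\Omega_{\mathcal F}(x)}{\Omega_{\mathcal F'}(x)}\partial+\frac{\Omega_{\mathcal F}'(x)+\Omega_{\mathcal F}(x)}{\Omega_{\mathcal F'}(x)},$$ $$B_{\mathcal F}=\frac{-x\,\Omega_{\mathcal F'}(x)}{\Omega_{\mathcal F}(x)}\partial+\frac{x\,(\Omega_{\mathcal F'})'(x)-(\alpha+k)\,\Omega_{\mathcal F'}(x)}{\Omega_{\mathcal F}(x)} .$$ Then $L_n^{\alpha;\mathcal F}=A_{\mathcal F}\big(L_{n-f_{k_2}^2+k_2-1}^{\alpha;\mathcal F'}\big)$ for $n\in\sigma_{\mathcal F}$. Moreover $$D_{\mathcal F'}=B_{\mathcal F}A_{\mathcal F}+(\alpha+f_{k_2}^2-u_{\mathcal F'}+1)\,Id,\qquad D_{\mathcal F}=A_{\mathcal F}B_{\mathcal F}+(\alpha+f_{k_2}^2-u_{\mathcal F}+1)\,Id .$$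
   Context: Laguerre polynomials: $L_n^\alpha(x)=\sum_{j=0}^n\frac{(-x)^j}{j!}\binom{n+\alpha}{n-j}$. $Id$ is the identity operator. For a pair $\mathcal H=(H_1,H_2)$ of finite sets of positive integers, let $k_i=|H_i|$, $k=k_1+k_2$, $$u_{\mathcal H}=\sum_{f\in H_1}f+\sum_{f\in H_2}f-\binom{k_1+1}{2}-\binom{k_2}{2},\qquad \sigma_{\mathcal H}=\{u_{\mathcal H},u_{\mathcal H}+1,\ldots\}\setminus\{u_{\mathcal H}+f: f\in H_1\}.$$ For $n\in\sigma_{\mathcal H}$, $L_n^{\alpha;\mathcal H}(x)$ is the determinant of the $(k+1)\times(k+1)$ matrix with columns indexed by $j=0,\ldots,k$ whose rows are, from top to bottom: $\big((L_{n-u_{\mathcal H}}^\alpha)^{(j)}(x)\big)_j$; then $\big((L_f^\alpha)^{(j)}(x)\big)_j$ for $f\in H_1$ (increasing order); then $\big(L_f^{\alpha+j}(-x)\big)_j$ for $f\in H_2$ (increasing order). Here $^{(j)}$ denotes the $j$-th derivative. $\Omega_{\mathcal H}(x)=\Omega_{\mathcal H}^\alpha(x)$ is the $k\times k$ determinant with columns indexed by $j=0,\ldots,k-1$ and rows $\big((L_f^\alpha)^{(j)}(x)\big)_j$ for $f\in H_1$ (increasing order), followed by $\big(L_f^{\alpha+j}(-x)\big)_j$ for $f\in H_2$ (increasing order). $D_{\mathcal H}=x\,\partial^2+h_1(x)\,\partial+h_0(x)$ with $$h_1(x)=\alpha+k+1-x-2x\frac{\Omega_{\mathcal H}'(x)}{\Omega_{\mathcal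 H}(x)},\qquad h_0(x)=-k_1-u_{\mathcal H}+(x-\alpha-k)\frac{\Omega_{\mathcal H}'(x)}{\Omega_{\mathcal H}(x)}+x\frac{\Omega_{\mathcal H}''(x)}{\Omega_{\mathcal H}(x)}.$$ Convention for $\mathcal H=(\emptyset,\emptyset)$: $u_{\mathcal H}=0$, $\sigma_{\mathcal H}=\{0,1,2,\ldots\}$, $\Omega_{\mathcal H}=1$, $L_n^{\alpha;\mathcal H}=L_n^\alpha$. *)

(* Defs.v *)
From HB Require Import structures.
From mathcomp Require Import all_boot all_order all_algebra.
From mathcomp Require Export finmap.
From mathcomp Require Export reals.
From mathcomp Require Import ring.

Set Implicit Arguments.
Unset Strict Implicit.
Unset Printing Implicit Defensive.

Import Order.TTheory GRing.Theory Num.Theory.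

Local Open Scope ring_scope.

Notation "x %:F" := (@FracField.tofrac _ x) : ring_scope.

Section RationalFunctions.
Variable R : idomainType.

(* Quotient rule on the chosen representative of a rational function;
   [ratder_quot] shows that the result does not depend on the representative. *)
Definition ratder (r : {fraction {poly R}}) : {fraction {poly R}} :=
  let n := \n_(repr r) in
  let d := \d_(repr r) in
  (n^`() * d - n * d^`())%:F / (d ^+ 2)%:F.

Lemma fraction_repr (r : {fraction {poly R}}) :
  r = (\n_(repr r))%:F / (\d_(repr r))%:F.
Proof.
have d0 : \d_(repr r) != 0 by exact: denom_ratioP.
rewrite -[LHS]reprK; unlock FracField.tofrac.
rewrite -[X in _ = _ * X]FracField.pi_inv -[RHS]FracField.pi_mul.
apply/eqmodP; rewrite /= FracField.equivfE /FracField.mulf /FracField.invf.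
by rewrite !numden_Ratio ?oner_neq0 ?mul1r ?mulr1 // mulrC.
Qed.

Lemma ratder_quot (n d : {poly R}) : d != 0 ->
  ratder (n%:F / d%:F) = (n^`() * d - n * d^`())%:F / (d ^+ 2)%:F.
Proof.
move=> d0; rewrite /ratder.
have /eqP := fraction_repr (n%:F / d%:F).
have d10 : \d_(repr (n%:F / d%:F)) != 0 by exact: denom_ratioP.
move: (\n_(repr _)) (\d_(repr _)) d10 => n1 d1 d10.
rewrite eqr_div ?tofrac_eq0 // -!tofracM tofrac_eq => /eqP E.
have E' : n^`() * d1 + n * d1^`() = n1^`() * d + n1 * d^`().
  by rewrite -!derivM E.
apply/eqP; rewrite eqr_div ?tofrac_eq0 ?expf_neq0 // -!tofracM tofrac_eq.
apply/eqP.
transitivity ((n1^`() * d + n1 * d^`()) * (d1 * d)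
              - (n1 * d) * (d1^`() * d + d1 * d^`())); first by ring.
by rewrite -E' -E; ring.
Qed.

End RationalFunctions.

Section ExceptionalLaguerre.
Variable R : fieldType.
Implicit Types (alpha : R) (H F : {fset nat} * {fset nat}).
Local Notation K := {fraction {poly R}}.
Local Notation "c %:K" := (c%:P%:F : K) (at level 2).
Local Notation x := ('X%:F : K).

Definition gbinom (a : R) (m : nat) : R :=
  (\prod_(i < m) (a - i%:R)) / (m`!)%:R.

Definition laguerre alpha (n : nat) : {poly R} :=
  \sum_(j < n.+1) (gbinom (n%:R + alpha) (n - j) / (j`!)%:R) *: (- 'X) ^+ j.

Definition cardH H : nat := (#|` H.1| + #|` H.2|)%N.

(* When H consists of positive integers, the sum is at least the subtracted
   quantity, so the subtraction in nat is not truncated. Likewise, for F' and f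
   obtained by removing f = max H.2 from H.2, and u_H <= n, one has
   n + #|H.2| - 1 - f = u_F' + (n - u_H), again without truncation. *)
Definition uH H : nat :=
  (\sum_(f <- H.1) f + \sum_(f <- H.2) f
   - ('C(#|` H.1|.+1, 2) + 'C(#|` H.2|, 2)))%N.

Definition sigmaH H : pred nat :=
  [pred n | (uH H <= n)%N && (n \notin [seq (uH H + f)%N | f <- H.1])].

(* A row is the function sending a column index to the entry. *)
Definition detrows (rows : seq (nat -> {poly R})) : {poly R} :=
  \det (\matrix_(i < size rows, j < size rows) nth (fun=> 0) rows i j).

Definition lagrow alpha (f : nat) : nat -> {poly R} :=
  fun j => (laguerre alpha f)^`(j).

Definition lagrowN alpha (f : nat) : nat -> {poly R} :=
  fun j => laguerre (alpha + j%:R) f \Po (- 'X).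

Definition Hrows alpha H : seq (nat -> {poly R}) :=
  [seq lagrow alpha f | f <- sort leq H.1]
  ++ [seq lagrowN alpha f | f <- sort leq H.2].

Definition Omega alpha H : {poly R} := detrows (Hrows alpha H).

Definition xlaguerre alpha H (n : nat) : {poly R} :=
  detrows (lagrow alpha (n - uH H) :: Hrows alpha H).

(* A differential operator with coefficients in R(x) is represented by its action
   on R(x), where d/dx is [ratder]; in characteristic 0 this action determines
   the coefficients, so equality of operators is equality of these maps. *)
Definition opD alpha H (r : K) : K :=
  let O := (Omega alpha H)%:F in
  let O' := (Omega alpha H)^`()%:F in
  let O'' := (Omega alpha H)^`(2)%:F in
  let k := cardH H in
  let h1 := (alpha + k%:R + 1)%:K - x - 2%:R * x * (O' / O) in
  let h0 := (- #|` H.1|%:R - (uH H)%:R)%:K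
            + (x - (alpha + k%:R)%:K) * (O' / O) + x * (O'' / O) in
  x * ratder (ratder r) + h1 * ratder r + h0 * r.

Definition maxF2 F : nat := (\max_(f <- F.2) f)%N.

Definition dropmax F : {fset nat} * {fset nat} :=
  (F.1, (F.2 `\ maxF2 F)%fset).

Definition opA alpha F (r : K) : K :=
  let O := Omega alpha F in
  let P := Omega alpha (dropmax F) in
  - (O%:F / P%:F) * ratder r + ((O^`() + O)%:F / P%:F) * r.

Definition opB alpha F (r : K) : K :=
  let O := Omega alpha F in
  let P := Omega alpha (dropmax F) in
  (- x * P%:F / O%:F) * ratder r
  + ((x * P^`()%:F - (alpha + (cardH F)%:R)%:K * P%:F) / O%:F) * r.

End ExceptionalLaguerre.

(* Main.v *)
(* Multiplied by [exp x], the rows of [Omega] indexed by [F.2] are Wronskian rows: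
   [L_f^(alpha+j)(-x) exp x] is the [j]-th derivative of [exp x L_f^alpha(-x)].
   Hence, up to an exponential factor, [Omega] and [L_n^(alpha;F)] are Wronskians
   of eigenfunctions of the Laguerre operator, and removing [max F.2] removes the
   last one. In Crum's iterated Darboux transformation a Wronskian is the product
   of the successive transformed seeds [psi_i], and each intermediate operator is
   intertwined with the Laguerre operator, so [psi_i] is again an eigenfunction.
   For the last step this says that [Omega_F / Omega_F'] gives a solution of a
   Riccati equation, which is equivalent to both factorizations. No [psi_i]
   vanishes: otherwise some seed would be a combination, with constant
   coefficients, of earlier seeds of the same exponential type, all of which have
   smaller degree.

   The factor [exp] is never introduced: a function [exp(c x) y] is represented by
   the pair [(c, y)], on which d/dx acts as [y |-> y' + c y]. *)
Require Import Defs.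
From mathcomp Require Import all_boot all_order all_algebra.
From mathcomp Require Import finmap reals.
From mathcomp Require Import ring zify.
Import GRing.Theory Num.Theory.
Local Open Scope ring_scope.

Set Implicit Arguments.
Unset Strict Implicit.
Unset Printing Implicit Defensive.

(** * Crum's iteration in a differential field *)

Section Crum.
Variables (K : fieldType) (D : K -> K).
Hypothesis derD : {morph D : a b / a + b}.
Hypothesis derM : forall a b, D (a * b) = D a * b + a * D b.

Lemma der0 : D 0 = 0.
Proof. by apply: (addrI (D 0)); rewrite -derD !addr0. Qed.

Lemma der1 : D 1 = 0.
Proof. by apply: (addrI (D 1)); rewrite addr0 -{3}[1]mulr1 derM mulr1 mul1r. Qed.

Lemma derN a : D (- a) = - D a.
Proof. by apply: (addrI (D a)); rewrite -derD !subrr der0. Qed.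

Lemma derB a b : D (a - b) = D a - D b.
Proof. by rewrite derD derN. Qed.

Lemma der_nat n : D n%:R = 0.
Proof. by elim: n => [|n IH]; rewrite ?der0 // -natr1 derD IH der1 addr0. Qed.

Lemma derV a : a != 0 -> D a^-1 = - D a / a ^+ 2.
Proof.
move=> a0; apply: (mulfI a0); apply: (addrI (D a * a^-1)).
by rewrite -derM divff // der1; field.
Qed.

Lemma der_div a b : b != 0 -> D (a / b) = (D a * b - a * D b) / b ^+ 2.
Proof. by move=> b0; rewrite derM derV //; field. Qed.

Lemma der_logprod (n : nat) (F : nat -> K) :
  (forall i, (i < n)%N -> F i != 0) ->
  \sum_(i < n) D (F i) / F i = D (\prod_(i < n) F i) / \prod_(i < n) F i.
Proof.
elim: n => [|n IH] F0; first by rewrite !big_ord0 der1 mul0r.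
rewrite !big_ord_recr /= IH; last by move=> i /ltnW; exact: F0.
have p0 : \prod_(i < n) F i != 0.
  by apply/prodf_neq0 => i _; apply: F0; exact: leqW (ltn_ord i).
have Fn0 := F0 n (ltnSn n).
rewrite derM; field.
by rewrite p0 Fn0.
Qed.

(* [twist c y] is [exp(-c x) (exp(c x) y)'] for a constant [c]. *)
Definition twist (c y : K) : K := D y + c * y.

Lemma twistD c a b : twist c (a + b) = twist c a + twist c b.
Proof. by rewrite /twist derD mulrDr addrACA. Qed.

Lemma twist0 c : twist c 0 = 0.
Proof. by rewrite /twist der0 mulr0 addr0. Qed.

Lemma twistM c a y : twist c (a * y) = D a * y + a * twist c y.
Proof. by rewrite /twist derM; ring. Qed.

Lemma twist_const c a y : D a = 0 -> twist c (a * y) = a * twist c y.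
Proof. by move=> a0; rewrite twistM a0 mul0r add0r. Qed.

Section Iteration.
Variables g f : nat -> K.

(* The pair [(g i, f i)] stands for the seed function [exp(g i x) f i]. *)
Fixpoint crum (k : nat) (c y : K) : K :=
  if k is k'.+1 then
    twist c (crum k' c y)
    - twist (g k') (crum k' (g k') (f k')) / crum k' (g k') (f k')
      * crum k' c y
  else y.

(** The [k]-th seed after [k] Darboux steps, without its exponential factor; [logder k] is the
    logarithmic derivative with that factor included. *)
Definition seed k := crum k (g k) (f k).
Definition logder k := twist (g k) (seed k) / seed k.

Lemma crumS k c y :
  crum k.+1 c y = twist c (crum k c y) - logder k * crum k c y.
Proof. by []. Qed.

Lemma crumD k c a b : crum k c (a + b) = crum k c a + crum k c b.
Proof. by elim: k => // k IH; rewrite !crumS IH twistD; ring. Qed.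

Lemma crum_const k c a y : D a = 0 -> crum k c (a * y) = a * crum k c y.
Proof. by move=> a0; elim: k => // k IH; rewrite !crumS IH twist_const //; ring. Qed.

(** Step [i] is built to annihilate seed [i], and every later step sends zero to zero. *)
Lemma crum_seed i k : (i < k)%N -> seed i != 0 -> crum k (g i) (f i) = 0.
Proof.
move=> ik si0; elim: k ik => // k IH; rewrite ltnS leq_eqVlt crumS.
case/orP => [/eqP <-|/IH ->]; last by rewrite twist0 mulr0 subrr.
by rewrite /logder -/(seed i) divfK ?subrr.
Qed.

(** Coefficients of [crum k c] as an operator in powers of [twist c]. They depend neither on [c] nor
    on the argument, so one set of column operations serves seeds of all exponential types. *)
Fixpoint crum_coef (k j : nat) : K :=
  if k is k'.+1 then
    D (crum_coef k' j) + (if j is j'.+1 then crum_coef k' j' else 0)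
    - logder k' * crum_coef k' j
  else (j == 0%N)%:R.

Lemma crum_coef_gt k j : (k < j)%N -> crum_coef k j = 0.
Proof.
elim: k j => [|k IH] [|j] //= kj.
by rewrite !IH ?der0 ?mulr0 ?addr0 ?subr0 //; exact: ltnW.
Qed.

Lemma crum_coef_lead k : crum_coef k k = 1.
Proof.
elim: k => //= k IH; rewrite IH crum_coef_gt // der0 mulr0 subr0.
by rewrite add0r.
Qed.

Lemma crum_expand k n c y : (k < n)%N ->
  crum k c y = \sum_(j < n) crum_coef k j * iter j (twist c) y.
Proof.
elim: k n => [|k IH] n kn.
  case: n kn => // n _; rewrite big_ord_recl big1 /= ?mul1r ?addr0 //.
  by move=> i _; rewrite mul0r.
case: n kn => // n; rewrite ltnS => kn.
rewrite crumS (IH n.+1 (leqW kn)).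
rewrite (big_morph (twist c) (@twistD c) (@twist0 c)).
rewrite mulr_sumr -sumrB /=.
under [RHS]eq_bigr do rewrite mulrBl mulrDl.
under eq_bigr do rewrite twistM.
rewrite !sumrB !big_split /=; congr (_ + _ - _); last first.
  by apply: eq_bigr => i _; rewrite mulrA.
rewrite big_ord_recr /= crum_coef_gt // mul0r addr0.
by rewrite big_ord_recl /= mul0r add0r.
Qed.

(** The last seed may vanish: the first [n] columns only divide by the earlier ones. *)
Lemma det_wronskian n : (forall i, (i < n.-1)%N -> seed i != 0) ->
  \det (\matrix_(i < n, j < n) iter j (twist (g i)) (f i))
  = \prod_(i < n) seed i.
Proof.
move=> s0; set M := (X in \det X).
(* Column operations turn the Wronskian matrix into the matrix of the
   [crum j (g i) (f i)], which vanish for [i < j]. *)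
pose U : 'M[K]_n := \matrix_(j, k) crum_coef k j.
have detU : \det U = 1.
  rewrite -det_tr det_trig; last first.
    by apply/is_trig_mxP => i j ij; rewrite !mxE crum_coef_gt.
  by rewrite big1 // => i _; rewrite !mxE crum_coef_lead.
have MU i k : (M *m U) i k = crum k (g i) (f i).
  rewrite mxE (@crum_expand k n) //; apply: eq_bigr => j _.
  by rewrite !mxE mulrC.
rewrite -[LHS]mulr1 -[X in _ * X = _]detU -det_mulmx det_trig.
  by apply: eq_bigr => i _; rewrite MU.
apply/is_trig_mxP => i j ij; rewrite MU crum_seed // s0 //.
by rewrite -ltnS prednK ?(leq_ltn_trans ij) //; exact: leq_ltn_trans (ltn_ord j).
Qed.

Section Intertwining.
Variables (x b : K) (lam : nat -> K).
Hypothesis Dx : D x = 1.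
Hypothesis Db : D b = -1.
Hypothesis Dg : forall i, D (g i) = 0.
Hypothesis Dlam : forall i, D (lam i) = 0.

(** Zeroth order coefficient after [k] Darboux steps: a step with logarithmic derivative [v] adds
    [-1 + v + 2 x v']. *)
Definition potential k : K :=
  - k%:R + \sum_(i < k) logder i + 2%:R * x * D (\sum_(i < k) logder i).

(** The [k]-th transformed operator conjugated by [exp(c x)]. For [k = 0] and [b = alpha + 1 - x] it
    comes from the Laguerre operator. *)
Definition laguerre_op k c y : K :=
  x * twist c (twist c y) + (b + k%:R) * twist c y + potential k * y.

Hypothesis f_eigen : forall i, laguerre_op 0 (g i) (f i) = lam i * f i.

(** Substitution of [y' = v y] in the eigenvalue equation; since [v] is taken with the exponential
    factor, the type [g k] disappears. *)
Lemma riccati_of_eigen k : seed k != 0 ->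
  laguerre_op k (g k) (seed k) = lam k * seed k ->
  x * (D (logder k) + logder k ^+ 2) + (b + k%:R) * logder k + potential k
  = lam k.
Proof.
move=> s0 E; apply: (mulIf s0); rewrite -E /laguerre_op.
have tw : twist (g k) (seed k) = logder k * seed k by rewrite /logder divfK.
by rewrite tw twistM tw; ring.
Qed.

(** The step [y' - v y] carries one operator to the next because the Riccati expression of [v] is
    constant: the induction hypothesis for seed [k] makes that seed an eigenfunction, so the
    expression equals [lam k]. *)
Lemma intertwine k : (forall i, (i < k)%N -> seed i != 0) ->
  forall c y, D c = 0 ->
  laguerre_op k c (crum k c y) = crum k c (laguerre_op 0 c y).
Proof.
elim: k => // k IH s0 c y Dc.
have {}IH : forall c y, D c = 0 ->
    laguerre_op k c (crum k c y) = crum k c (laguerre_op 0 c y).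
  by apply: IH => i /ltnW; exact: s0.
have ric : x * (D (logder k) + logder k ^+ 2) + (b + k%:R) * logder k
           + potential k = lam k.
  apply: riccati_of_eigen; first exact: s0.
  by rewrite IH // f_eigen crum_const.
have dric : D (x * (D (logder k) + logder k ^+ 2) + (b + k%:R) * logder k
           + potential k) = 0 by rewrite ric.
have potS : potential k.+1
    = potential k - 1 + logder k + 2%:R * x * D (logder k).
  by rewrite /potential big_ord_recr /= derD -natr1; ring.
rewrite !crumS -IH // /laguerre_op potS -natr1.
move: (logder k) (crum k c y) (potential k) dric => v z e.
rewrite !expr2 !(derD, derM) Dx Db der_nat => dric.
rewrite /twist !(derN, derD, derM) Dx Db Dc der_nat der0.
move: (D e) (D (D v)) dric => De DDv dric.
apply/eqP; rewrite -subr_eq0; apply/eqP.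
(* The two sides differ by [- z] times the derivative of the Riccati expression. *)
transitivity (- z * 0); last exact: mulr0.
by rewrite -[X in _ = _ * X]dric; ring.
Qed.

Lemma riccati k : (forall i, (i <= k)%N -> seed i != 0) ->
  x * (D (logder k) + logder k ^+ 2) + (b + k%:R) * logder k + potential k
  = lam k.
Proof.
move=> s0; apply: riccati_of_eigen; first exact: s0.
by rewrite intertwine // ?f_eigen ?crum_const // => i /ltnW; exact: s0.
Qed.

End Intertwining.
End Iteration.

Lemma eq_crum (g g' f f' : nat -> K) k :
  (forall i, (i < k)%N -> g i = g' i /\ f i = f' i) ->
  forall c y, crum g f k c y = crum g' f' k c y.
Proof.
elim: k => // k IH E c y; have [gk fk] := E k (ltnSn k).
have {}IH := IH (fun i ik => E i (ltnW ik)).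
by rewrite /= !IH gk fk.
Qed.

End Crum.

(** * Operator factorizations from a solution of the Riccati equation *)

Section DarbouxFactorization.
Variables (K : fieldType) (D : K -> K).
Hypothesis derD : {morph D : a b / a + b}.
Hypothesis derM : forall a b, D (a * b) = D a * b + a * D b.
Variables (x a k1 k2 lam O P : K).
Hypotheses (Dx : D x = 1) (Da : D a = 0) (Dk1 : D k1 = 0) (Dk2 : D k2 = 0).
Hypotheses (O0 : O != 0) (P0 : P != 0).
Let v := 1 + D O / O - D P / P.
Hypothesis ric : x * (D v + v ^+ 2) + (a + 1 - x + (k1 + k2)) * v
  + (- (k1 + k2) + (k2 + D P / P) + 2%:R * x * D (k2 + D P / P)) = lam.
Let A r := - (O / P) * D r + ((D O + O) / P) * r.
Let B r := (- x * P / O) * D r + ((x * D P - (a + (k1 + k2 + 1)) * P) / O) * r.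

(** Put [b = a + 1 - x], [k = k1 + k2], and let [T] be the operator with coefficients [x], [b + k]
    and the potential in [ric]. The left side is [P T P^-1 - u], while [A = - O (D - v) P^-1] and
    [B = - P (x D + x v + b + k) O^-1]. By [ric], [T - lam = (x D + x v + b + k) (D - v)]. *)
Lemma factor_BA u r :
  x * D (D r) + (a + (k1 + k2) + 1 - x - 2%:R * x * (D P / P)) * D r
  + (- k1 - u + (x - (a + (k1 + k2))) * (D P / P) + x * (D (D P) / P)) * r
  = B (A r) + (lam - u) * r.
Proof.
rewrite -ric /A /B /v !expr2.
rewrite !(derN derD, derD, derM, derV derM O0, derV derM P0, der1 derM).
rewrite Dk2.
move: (D (D P)) (D (D O)) (D (D r)) (D P) (D O) (D r) => P2 O2 r2 P1 O1 r1.
by field; rewrite O0 P0.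
Qed.

(** The same two factors in the opposite order give the next operator minus [lam], now conjugated by
    [O]. *)
Lemma factor_AB u r :
  x * D (D r) + (a + (k1 + k2 + 1) + 1 - x - 2%:R * x * (D O / O)) * D r
  + (- k1 - u + (x - (a + (k1 + k2 + 1))) * (D O / O) + x * (D (D O) / O)) * r
  = A (B r) + (lam - u) * r.
Proof.
rewrite -ric /A /B /v !expr2.
rewrite !(derN derD, derD, derM, derV derM O0, derV derM P0, der1 derM).
rewrite Dk2 Dk1 Da Dx.
move: (D (D P)) (D (D O)) (D (D r)) (D P) (D O) (D r) => P2 O2 r2 P1 O1 r1.
by field; rewrite O0 P0.
Qed.
End DarbouxFactorization.

(** * Rational functions and the seeds *)

(* The field of rational functions is kept abstract ([K], with embedding [tau] and
   derivation [dr]): in [{fraction {poly R}}] conversion unfolds the polynomial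
   structures and [field] or [_ != 0] make type checking diverge. *)
Section RationalFunctions.
Variables (R : fieldType) (K : fieldType) (tau : {rmorphism {poly R} -> K}).
Variable dr : K -> K.
Hypothesis charR0 : forall n : nat, n.+1%:R != 0 :> R.
Hypothesis tau_inj : injective tau.
Hypothesis tau_frac : forall r, exists n d : {poly R}, d != 0 /\ r = tau n / tau d.
Hypothesis dr_quot : forall n d : {poly R}, d != 0 ->
  dr (tau n / tau d) = tau (n^`() * d - n * d^`()) / tau (d ^+ 2).
Implicit Types (p n d : {poly R}) (r : K).
Local Notation "c %:K" := (tau c%:P) (at level 2).

Lemma tau_neq0 p : p != 0 -> tau p != 0.
Proof. by apply: contra => /eqP p0; apply/eqP/tau_inj; rewrite p0 rmorph0. Qed.

Lemma dr_tau p : dr (tau p) = tau p^`().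
Proof.
rewrite -[tau p]divr1 -(rmorph1 tau) dr_quot ?oner_neq0 //.
by rewrite derivC mulr1 mulr0 subr0 expr1n rmorph1 divr1.
Qed.

Lemma drD : {morph dr : a b / a + b}.
Proof.
move=> a b.
have [n [d [d0 ->]]] := tau_frac a; have [n' [d' [d'0 ->]]] := tau_frac b.
have F0 := tau_neq0 d0; have F'0 := tau_neq0 d'0.
rewrite addf_div // -!rmorphM -rmorphD !dr_quot ?mulf_neq0 //.
rewrite !(derivM, derivD) !(rmorphM, rmorphB, rmorphD, rmorphXn) /=.
by field; rewrite F0 F'0.
Qed.

Lemma drM (a b : K) : dr (a * b) = dr a * b + a * dr b.
Proof.
have [n [d [d0 ->]]] := tau_frac a; have [n' [d' [d'0 ->]]] := tau_frac b.
have F0 := tau_neq0 d0; have F'0 := tau_neq0 d'0.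
rewrite mulf_div -!rmorphM !dr_quot ?mulf_neq0 //.
rewrite !(derivM, derivD) !(rmorphM, rmorphB, rmorphD, rmorphXn) /=.
by field; rewrite F0 F'0.
Qed.

Lemma drC (a : R) : dr a%:K = 0.
Proof. by rewrite dr_tau derivC rmorph0. Qed.

Lemma natr_inj0 (m n : nat) : m%:R = n%:R :> R -> m = n.
Proof.
wlog mn : m n / (m <= n)%N => [H|E].
  by case/orP: (leq_total m n) => mn E; [|apply: esym]; apply: H.
apply/eqP; rewrite eqn_leq mn /= leqNgt; apply/negP => nm.
have := charR0 (n - m).-1; rewrite prednK ?subn_gt0 //.
by rewrite natrB // E subrr eqxx.
Qed.

Lemma lead_coef_deriv p : lead_coef p^`() = lead_coef p *+ (size p).-1.
Proof.
have [p1|p1] := leqP (size p) 1.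
  rewrite [p in p^`()]size1_polyC // derivC lead_coef0.
  by case: (size p) p1 => [|[]].
case sp: (size p) p1 => [|[|m]] // _.
have pm : p^`()`_m = lead_coef p *+ m.+1 by rewrite coef_deriv lead_coefE sp.
have p'0 : p^`()`_m != 0.
  rewrite pm -mulr_natr mulf_neq0 ?charR0 // lead_coef_eq0.
  by rewrite -size_poly_eq0 sp.
have m_lt : (m < size p^`())%N.
  by rewrite ltnNge; apply: contra p'0 => /leq_sizeP ->.
have lt_m : (size p^`() < m.+2)%N.
  by rewrite -sp lt_size_deriv // -size_poly_eq0 sp.
have sp' : size p^`() = m.+1 by apply/eqP; rewrite eqn_leq -ltnS lt_m.
by rewrite lead_coefE sp' pm.
Qed.

(** The equation says that [r = n / d] satisfies [r' = a r]. Its left side has smaller degree than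
    [n * d], so [a = 0]; leading coefficients in [n' d = n d'] then force equal degrees. *)
Lemma wronskian_eigen_size (a : R) n d : n != 0 -> d != 0 ->
  n^`() * d - n * d^`() = a *: (n * d) -> a = 0 /\ size n = size d.
Proof.
move=> n0 d0 E.
have sn := lt_size_deriv n0; have sd := lt_size_deriv d0.
have a0 : a = 0.
  apply/eqP; apply: contraT => a0.
  have := size_scale (n * d) a0; rewrite -E size_mul // => sE.
  have := size_polyD (n^`() * d) (- (n * d^`())); rewrite size_polyN.
  have := size_polyMleq n^`() d; have := size_polyMleq n d^`().
  rewrite sE leq_max => sB sA /orP[/leq_trans/(_ sA)|/leq_trans/(_ sB)].
    by move: (size n) (size d) (size _) sn sd => *; lia.
  by move: (size n) (size d) (size d^`()) sn sd => *; lia.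
split=> //; move: E; rewrite a0 scale0r => /eqP; rewrite subr_eq0 => /eqP E.
have nd0 : lead_coef n * lead_coef d != 0 by rewrite mulf_neq0 ?lead_coef_eq0.
have := congr1 lead_coef E.
rewrite !lead_coefM !lead_coef_deriv mulrnAl mulrnAr.
rewrite -[LHS]mulr_natl -[RHS]mulr_natl => /(mulIf nd0)/natr_inj0.
by move: n0 d0; rewrite -!size_poly_gt0; case: (size n) (size d) => [|?] [|?] //= _ _ ->.
Qed.

Lemma dr_eigenE (a : R) n d : d != 0 ->
  dr (tau n / tau d) = a%:K * (tau n / tau d) ->
  n^`() * d - n * d^`() = a *: (n * d).
Proof.
move=> d0 E; have F0 := tau_neq0 d0.
apply: tau_inj; rewrite -mul_polyC.
transitivity (a%:K * (tau n / tau d) * tau (d ^+ 2)).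
  by rewrite -E dr_quot // mulfVK // tau_neq0 ?expf_neq0.
by rewrite !(rmorphM, rmorphXn) /=; field.
Qed.

Lemma dr_eigen (a : R) r : a != 0 -> dr r = a%:K * r -> r = 0.
Proof.
move=> a0; have [n [d [d0 ->]]] := tau_frac r => /(dr_eigenE d0) E.
have [->|n0] := eqVneq n 0; first by rewrite rmorph0 mul0r.
by have [/eqP] := wronskian_eigen_size n0 d0 E; rewrite (negbTE a0).
Qed.

Lemma dr_eq0 r : dr r = 0 -> exists a : R, r = a%:K.
Proof.
have [n [d [d0 ->]]] := tau_frac r => E.
have F0 := tau_neq0 d0.
have rE a : tau n / tau d - a%:K = tau (n - a *: d) / tau d.
  by rewrite rmorphB -mul_polyC rmorphM /=; field.
(* This [a] cancels the coefficient of [n - a *: d] in the degree of [d], whereas a nonzero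
   [n - a *: d] would have exactly that degree. *)
pose a := n`_(size d).-1 / lead_coef d; exists a.
apply/eqP; rewrite -subr_eq0; apply/eqP.
rewrite rE; have [->|n0] := eqVneq (n - a *: d) 0; first by rewrite rmorph0 mul0r.
have {}E : dr (tau (n - a *: d) / tau d) = 0%:K * (tau (n - a *: d) / tau d).
  by rewrite -rE (derB drD) E drC subr0 polyC0 rmorph0 mul0r.
have [_ sE] := wronskian_eigen_size n0 d0 (dr_eigenE d0 E).
move: n0; rewrite -lead_coef_eq0 lead_coefE sE coefB coefZ.
by rewrite -[d`_ _]lead_coefE /a divfK ?lead_coef_eq0 // subrr eqxx.
Qed.

(** * Nonvanishing of the transformed seeds *)

Section SeedsNonzero.
Variable s : nat -> R * {poly R}.
Let g i : K := (s i).1%:K.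
Let f i : K := tau (s i).2.

(** Stated for an arbitrary [p] because the induction replaces [p] by [p - a *: (s k).2], which has
    the same size. *)
Lemma crum_tau_neq0 k (c : R) p :
  (forall i, (i < k)%N -> seed dr g f i != 0) ->
  (forall i, (i < k)%N -> (s i).1 = c -> (size (s i).2 < size p)%N) ->
  p != 0 -> crum dr g f k c%:K (tau p) != 0.
Proof.
elim: k p => [|k IH] p s0 sp p0; first exact: tau_neq0.
have s0' i : (i < k)%N -> seed dr g f i != 0 by move/leqW; exact: s0.
have sk := s0 k (ltnSn k).
have zp : crum dr g f k c%:K (tau p) != 0.
  by apply: IH => // i /leqW; exact: sp.
apply/eqP; rewrite crumS => /eqP; rewrite subr_eq0 => /eqP E.
(* Otherwise [z] solves [z' = (c_k - c) z], so it is [0] or a constant; a constant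
   multiple of the [k]-th seed can then be subtracted from [p]. *)
pose z := crum dr g f k c%:K (tau p) / seed dr g f k.
have Dz : dr z = (g k - c%:K) * z.
  rewrite (der_div drM) //.
  have -> : dr (crum dr g f k c%:K (tau p))
      = logder dr g f k * crum dr g f k c%:K (tau p)
        - c%:K * crum dr g f k c%:K (tau p) by rewrite -E addrK.
  by rewrite /logder /twist /z; field.
have zE : crum dr g f k c%:K (tau p) = z * seed dr g f k by rewrite divfK.
have [gc|gc] := eqVneq (s k).1 c; last first.
  have z0 : z = 0.
    by apply: (@dr_eigen ((s k).1 - c)); rewrite ?subr_eq0 // Dz polyCB rmorphB.
  by case/eqP: zp; rewrite zE z0 mul0r.
have [|a za] := @dr_eq0 z; first by rewrite Dz /g gc subrr mul0r.
have spk : (size (- (a *: (s k).2)) < size p)%N.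
  by rewrite size_polyN; apply: leq_ltn_trans (size_scale_leq _ _) (sp k _ gc).
have : crum dr g f k c%:K (tau (p - a *: (s k).2)) != 0.
  apply: (IH _ s0').
    by move=> i ik ic; rewrite size_polyDl //; apply: sp => //; exact: leqW.
  by rewrite -size_poly_eq0 size_polyDl // size_poly_eq0.
move/eqP; apply.
rewrite -scaleNr rmorphD -mul_polyC rmorphM.
rewrite (crumD drD) (crum_const drM) ?drC //.
by rewrite zE za /seed /g gc -mulrDl -rmorphD -polyCD subrr polyC0 rmorph0 mul0r.
Qed.

Lemma seed_tau_neq0 (n : nat) :
  (forall i, (i < n)%N -> (s i).2 != 0) ->
  (forall i j, (i < j < n)%N -> (s i).1 = (s j).1 ->
    (size (s i).2 < size (s j).2)%N) ->
  forall k, (k < n)%N -> seed dr g f k != 0.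
Proof.
move=> p0 sp k; elim/ltn_ind: k => k IH kn.
apply: crum_tau_neq0 => [i ik|i ik|]; last exact: p0.
- by apply: IH => //; exact: ltn_trans kn.
- by apply: sp; rewrite ik.
Qed.

End SeedsNonzero.

End RationalFunctions.

(** * Laguerre polynomials *)

Section Laguerre.
Variable R : fieldType.
Hypothesis charR0 : forall n : nat, n.+1%:R != 0 :> R.
Implicit Types (alpha a : R) (n m i : nat).

Lemma gbinom0 a : gbinom a 0 = 1.
Proof. by rewrite /gbinom big_ord0 fact0 divr1. Qed.

Lemma factf_neq0 n : (n`!)%:R != 0 :> R.
Proof. by rewrite -[n`!]prednK ?fact_gt0 ?charR0. Qed.

Lemma gbinomS a m : gbinom a m.+1 * m.+1%:R = gbinom a m * (a - m%:R).
Proof.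
rewrite /gbinom big_ord_recr /= factS natrM.
move: (charR0 m) (factf_neq0 m); move: m.+1%:R (m`!)%:R => u v u0 v0.
by field; rewrite u0 v0.
Qed.

Lemma gbinom_pascal a m :
  gbinom (a + 1) m.+1 = gbinom a m.+1 + gbinom a m.
Proof.
apply: (mulIf (charR0 m)); rewrite mulrDl (gbinomS a).
rewrite {1}/gbinom big_ord_recl /= subr0 factS natrM.
have aS (i : nat) : a + 1 - (bump 0 i)%:R = a - i%:R.
  by rewrite /bump /= add1n -natr1; ring.
under eq_bigr => i _ do rewrite aS.
have -> : (\prod_(i < m) (a - i%:R)) = gbinom a m * (m`!)%:R.
  by rewrite /gbinom divfK ?factf_neq0.
rewrite -[X in _ = _ + _ * X]natr1.
move: (charR0 m) (factf_neq0 m); move: m.+1%:R (m`!)%:R => u v u0 v0.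
by field; rewrite u0 v0.
Qed.

Lemma coef_laguerre alpha n i : (laguerre alpha n)`_i =
  if (i <= n)%N then gbinom (n%:R + alpha) (n - i) / (i`!)%:R * (-1) ^+ i else 0.
Proof.
rewrite /laguerre coef_sum.
have cX (j : nat) : ((- 'X : {poly R}) ^+ j)`_i = (-1) ^+ j * (i == j)%:R.
  have E : (- 'X) ^+ j = ((-1) ^+ j)%:P * 'X^j :> {poly R}.
    by rewrite polyC_exp polyCN polyC1 -exprMn mulN1r.
  by rewrite E mul_polyC coefZ coefXn.
under eq_bigr => j _ do rewrite coefZ cX.
case: leqP => [|ni].
  rewrite -ltnS => ni; rewrite (bigD1 (Ordinal ni)) //= eqxx mulr1 big1 ?addr0 //.
  move=> j; rewrite -val_eqE /= eq_sym => /negbTE ->.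
  by rewrite !mulr0.
rewrite big1 // => j _; rewrite gtn_eqF ?mulr0 //.
exact: leq_trans (ltn_ord j) ni.
Qed.

Lemma size_laguerre alpha n : size (laguerre alpha n) = n.+1.
Proof.
apply/eqP; rewrite eqn_leq; apply/andP; split.
  by apply/leq_sizeP => j nj; rewrite coef_laguerre leqNgt nj.
rewrite ltnNge; apply/negP => /leq_sizeP/(_ n (leqnn n))/eqP; apply/negP.
rewrite coef_laguerre leqnn subnn gbinom0.
by rewrite mulf_neq0 ?signr_eq0 // mul1r invr_eq0 factf_neq0.
Qed.

(** Pascal's rule on each coefficient. Raising the parameter thus amounts to differentiating, which
    turns the rows of [F.2] into Wronskian rows. *)
Lemma laguerre_shift alpha n :
  laguerre (alpha + 1) n = laguerre alpha n - (laguerre alpha n)^`().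
Proof.
apply/polyP => i; rewrite coefB coef_deriv !coef_laguerre addrA.
have i1 := charR0 i; have i2 := factf_neq0 i.
case: ltngtP => [ni|ni|->]; last first.
- by rewrite subnn !gbinom0 mul0rn subr0.
- by rewrite mul0rn subr0.
rewrite -[in LHS](subnSK ni) gbinom_pascal (subnSK ni).
rewrite factS natrM exprS -[X in _ = _ - X]mulr_natr.
move: i.+1%:R (i`!)%:R i1 i2 => u v i1 i2.
by field; rewrite i1 i2.
Qed.

Lemma laguerre_ode alpha n :
  'X * (laguerre alpha n)^`()^`() + ((alpha + 1)%:P - 'X) * (laguerre alpha n)^`()
  + n%:R *: laguerre alpha n = 0.
Proof.
apply/polyP => i; rewrite coef0 !mulrBl !(coefD, coefN) coefZ mul_polyC coefZ !coefXM.
have -> : (if i == 0%N then 0 else (laguerre alpha n)^`()^`()`_i.-1)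
          = (laguerre alpha n)`_i.+1 * i.+1%:R * i%:R.
  by case: i => [|i]; rewrite /= ?mulr0 // !coef_deriv !mulr_natr.
have -> : (if i == 0%N then 0 else (laguerre alpha n)^`()`_i.-1)
          = (laguerre alpha n)`_i * i%:R.
  by case: i => [|i]; rewrite /= ?mulr0 // !coef_deriv !mulr_natr.
have -> : (laguerre alpha n)^`()`_i = (laguerre alpha n)`_i.+1 * i.+1%:R.
  by rewrite coef_deriv mulr_natr.
rewrite !coef_laguerre.
have i1 := charR0 i; have i2 := factf_neq0 i.
case: ltngtP => [ni|ni|->]; last by ring.
  2: by ring.
have := gbinomS (n%:R + alpha) (n - i.+1); rewrite subnSK // => E.
have nE : (n - i)%:R = n%:R - i%:R :> R by rewrite natrB // ltnW.
have nE' : (n - i.+1)%:R = n%:R - i%:R - 1 :> R.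
  by rewrite natrB // -natr1; ring.
rewrite nE nE' in E; rewrite factS natrM exprS.
(* The coefficient of [X^i] is the recurrence [E] between consecutive binomials, up to the factor
   [(-1)^i / i!]. *)
transitivity ((gbinom (n%:R + alpha) (n - i) * (n%:R - i%:R)
  - gbinom (n%:R + alpha) (n - i.+1) * (n%:R + alpha - (n%:R - i%:R - 1)))
  / (i`!)%:R * (-1) ^+ i); last by rewrite E subrr !mul0r.
have -> : i%:R = i.+1%:R - 1 :> R by rewrite -natr1 addrK.
move: i.+1%:R (i`!)%:R i1 i2 => u v i1 i2.
by field; rewrite i1 i2.
Qed.

Definition laguerre_neg alpha n : {poly R} := laguerre alpha n \Po (- 'X).

Lemma size_laguerre_neg alpha n : size (laguerre_neg alpha n) = n.+1.
Proof.
by rewrite /laguerre_neg size_comp_poly2 ?size_laguerre // size_polyN size_polyX.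
Qed.

Lemma deriv_laguerre_neg alpha n :
  (laguerre_neg alpha n)^`() = - ((laguerre alpha n)^`() \Po (- 'X)).
Proof. by rewrite /laguerre_neg deriv_comp derivN derivX mulrN mulr1. Qed.

Lemma laguerre_neg_shift alpha n :
  laguerre_neg (alpha + 1) n = (laguerre_neg alpha n)^`() + laguerre_neg alpha n.
Proof.
by rewrite deriv_laguerre_neg /laguerre_neg laguerre_shift rmorphB addrC.
Qed.

Lemma laguerre_neg_ode alpha n :
  'X * (laguerre_neg alpha n)^`()^`()
  + ((alpha + 1)%:P + 'X) * (laguerre_neg alpha n)^`()
  = n%:R *: laguerre_neg alpha n.
Proof.
have := congr1 (comp_poly (- 'X)) (laguerre_ode alpha n).
rewrite 2!comp_polyD 2!comp_polyM comp_polyB comp_polyX !comp_polyC comp_polyZ.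
rewrite deriv_laguerre_neg derivN deriv_comp.
rewrite derivN derivX -/(laguerre_neg alpha n).
move=> /eqP; rewrite addr_eq0 => /eqP E.
by rewrite -[RHS]opprK -E; ring.
Qed.

End Laguerre.

(** * Index sets and determinants *)

Section IndexSets.
Implicit Types (S : {fset nat}) (F : {fset nat} * {fset nat}).

Lemma sorted_sort_fset S : sorted ltn (sort leq S).
Proof.
rewrite ltn_sorted_uniq_leq sort_uniq fset_uniq /=.
exact: (sort_sorted leq_total).
Qed.

(** The successive entries are at least [b + 1], [b + 2], and so on. *)
Lemma path_sumn_ge b (s : seq nat) : path ltn b s ->
  ('C((size s).+1, 2) + size s * b <= sumn s)%N.
Proof.
elim: s b => //= a s IH b /andP[ba /IH ge_s].
have ge_a : ((size s).+1 * b.+1 <= (size s).+1 * a)%N by rewrite leq_mul2l ba orbT.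
by rewrite binS bin1; move: 'C(_, _) ge_s ge_a => c; nia.
Qed.

Lemma sum_fset_ge S : (forall f, f \in S -> (0 < f)%N) ->
  ('C(#|` S|.+1, 2) <= \sum_(f <- S) f)%N.
Proof.
move=> S0; have pS : perm_eq (sort leq S) S by rewrite perm_sort.
rewrite -(perm_big _ pS) /= -sumnE -(perm_size pS).
apply: (leq_trans _ (@path_sumn_ge 0 _ _)); first by rewrite muln0 addn0.
have := sorted_sort_fset S; have : all (ltn 0) (sort leq S).
  by apply/allP => f; rewrite mem_sort; exact: S0.
by case: (sort leq S) => //= a s /andP[-> _].
Qed.

Lemma bigmax_mem (s : seq nat) : s != [::] -> (\max_(f <- s) f)%N \in s.
Proof.
elim: s => //= a [|b s] IH _; first by rewrite big_seq1 inE.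
rewrite big_cons; have := IH isT; set M := (X in X \in _) => Ms.
by rewrite /maxn; case: ifP => _; rewrite in_cons ?Ms ?eqxx ?orbT.
Qed.

Lemma maxF2_mem F : F.2 <> fset0 -> maxF2 F \in F.2.
Proof.
move=> F0; apply: bigmax_mem; rewrite -size_eq0 cardfs_eq0.
exact/eqP.
Qed.

Lemma maxF2_ge F f : f \in F.2 -> (f <= maxF2 F)%N.
Proof. by move=> fF; rewrite /maxF2 (big_rem f) //= leq_maxl. Qed.

Lemma perm_dropmax F : F.2 <> fset0 ->
  perm_eq F.2 (maxF2 F :: (dropmax F).2).
Proof.
move=> F0; apply: uniq_perm; rewrite ?fset_uniq //=.
  by rewrite fset_uniq andbT !inE eqxx.
by move=> f; rewrite !inE; case: eqVneq => [->|] //=; rewrite maxF2_mem.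
Qed.

Lemma sort_dropmax F : F.2 <> fset0 ->
  sort leq F.2 = rcons (sort leq (dropmax F).2) (maxF2 F).
Proof.
move=> F0; apply: (sorted_eq leq_trans anti_leq).
- exact: (sort_sorted leq_total).
- have : sorted leq (sort leq (dropmax F).2) := sort_sorted leq_total _.
  have : {in sort leq (dropmax F).2, forall f, f <= maxF2 F}%N.
    by move=> f; rewrite mem_sort !inE => /andP[_]; exact: maxF2_ge.
  case: (sort _ _) => //= a s le_m s_sorted.
  by rewrite rcons_path s_sorted le_m ?mem_last.
- rewrite perm_sort (perm_trans (perm_dropmax F0)) //.
  by rewrite perm_sym perm_rcons perm_cons perm_sort.
Qed.

(** The sum loses [maxF2 F], and the binomial of [F.2] loses the cardinality of [(dropmax F).2]. The
    lower bounds on the sums ensure that no subtraction in [uH] is truncated. *)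
Lemma uH_dropmax F :
  (forall f, f \in F.1 -> (0 < f)%N) -> (forall f, f \in F.2 -> (0 < f)%N) ->
  F.2 <> fset0 ->
  (uH F + #|` (dropmax F).2| = uH (dropmax F) + maxF2 F)%N.
Proof.
move=> F1 F2 F0; have := sum_fset_ge F1.
have F'2 f : f \in (dropmax F).2 -> (0 < f)%N.
  by rewrite !inE => /andP[_]; exact: F2.
have := sum_fset_ge F2; have := sum_fset_ge F'2; rewrite /uH.
rewrite !(perm_big _ (perm_dropmax F0)) /= big_cons (perm_size (perm_dropmax F0)) /=.
rewrite !binS !bin1 !bin0; lia.
Qed.

(** The boolean tells whether the seed carries the factor [exp x], as those of [F.2] do. *)
Definition labels F : seq (bool * nat) :=
  [seq (false, f) | f <- sort leq F.1] ++ [seq (true, f) | f <- sort leq F.2].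

Lemma size_labels F : size (labels F) = cardH F.
Proof. by rewrite size_cat !size_map !size_sort. Qed.

(** Removing the maximum removes the last seed, so the Wronskian of [dropmax F] is the previous
    stage of the same iteration. *)
Lemma labels_dropmax F : F.2 <> fset0 ->
  labels F = rcons (labels (dropmax F)) (true, maxF2 F).
Proof. by move=> F0; rewrite /labels sort_dropmax // map_rcons rcons_cat. Qed.

(** This is the degree condition under which no transformed seed vanishes. Positions in different
    blocks have different types. *)
Lemma labels_increasing F l0 i j : (i < j < size (labels F))%N ->
  (nth l0 (labels F) i).1 = (nth l0 (labels F) j).1 ->
  ((nth l0 (labels F) i).2 < (nth l0 (labels F) j).2)%N.
Proof.
have mono (b : bool) S i' j' : (i' < j' < #|` S|)%N ->
    ((nth l0 [seq (b, f) | f <- sort leq S] i').2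
     < (nth l0 [seq (b, f) | f <- sort leq S] j').2)%N.
  case/andP=> ij jS; have sS : size (sort leq S) = #|` S| by rewrite size_sort.
  rewrite !(nth_map 0%N) ?sS ?(ltn_trans ij) //=.
  apply: (sorted_ltn_nth ltn_trans) => //; rewrite ?inE ?sS ?(ltn_trans ij) //.
  exact: sorted_sort_fset.
rewrite size_labels /cardH /labels !nth_cat size_map size_sort => /andP[ij jk].
case: ltnP => [i1|i1]; case: ltnP => [j1|j1].
- by move=> _; apply: mono; rewrite ij.
- rewrite !(nth_map 0%N) ?size_sort //.
  by rewrite ltn_subLR.
- by move: (leq_trans (ltn_trans ij j1) i1); rewrite ltnn.
- by move=> _; apply: mono; rewrite ltn_sub2rE // ij ltn_subLR.
Qed.

End IndexSets.

Section Rows.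
Variable R : fieldType.

Lemma detrowsE (rows : seq (nat -> {poly R})) n : size rows = n ->
  detrows rows = \det (\matrix_(i < n, j < n) nth (fun=> 0) rows i j).
Proof. by move=> <-. Qed.

(** Expansion along the moved row: the minors agree and only the sign changes. In [xlaguerre] the
    new row is on top, while Crum's iteration takes it last. *)
Lemma detrows_cons (y : nat -> {poly R}) rows :
  detrows (y :: rows) = (-1) ^+ size rows * detrows (rcons rows y).
Proof.
rewrite (@detrowsE _ (size rows).+1) // (@detrowsE _ (size rows).+1) ?size_rcons //.
rewrite (expand_det_row _ ord0) (expand_det_row _ ord_max) mulr_sumr.
apply: eq_bigr => j _; rewrite !mxE nth_rcons ltnn eqxx /cofactor.
have sgn (d : {poly R}) :
    (-1) ^+ size rows * ((-1) ^+ (size rows + j) * d) = (-1) ^+ j * d.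
  by rewrite exprD -mulrA mulrA -expr2 sqrr_sign mul1r.
rewrite [in RHS]mulrCA sgn; congr (_ * (_ * \det _)).
apply/matrixP => i l; rewrite !mxE lift_max lift0 /= nth_rcons.
by rewrite ltn_ord.
Qed.

Variable alpha : R.

Definition seed_poly (l : bool * nat) : {poly R} :=
  if l.1 then laguerre_neg alpha l.2 else laguerre alpha l.2.

Definition seed_row (l : bool * nat) : nat -> {poly R} :=
  if l.1 then lagrowN alpha l.2 else lagrow alpha l.2.

Lemma Hrows_labels F : Hrows alpha F = map seed_row (labels F).
Proof. by rewrite /Hrows /labels map_cat -!map_comp. Qed.

End Rows.

(** * Factorization of the operators *)

Section Factorization.
Variables (R : fieldType) (K : fieldType) (tau : {rmorphism {poly R} -> K}).
Variable dr : K -> K.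
Hypothesis charR0 : forall n : nat, n.+1%:R != 0 :> R.
Hypothesis tau_inj : injective tau.
Hypothesis tau_frac : forall r, exists n d : {poly R}, d != 0 /\ r = tau n / tau d.
Hypothesis dr_quot : forall n d : {poly R}, d != 0 ->
  dr (tau n / tau d) = tau (n^`() * d - n * d^`()) / tau (d ^+ 2).
Local Notation "c %:K" := (tau c%:P) (at level 2).
Let dr_tauE := dr_tau dr_quot.
Let derD := drD tau_inj tau_frac dr_quot.
Let derM := drM tau_inj tau_frac dr_quot.
Let dr_constE := drC dr_quot.

Variable alpha : R.

Section Seeds.
Variable lab : nat -> bool * nat.

Definition seed_type i : K := (lab i).1%:R%:K.
Definition seed_fun i : K := tau (seed_poly alpha (lab i)).
(** Eigenvalues of the Laguerre operator on [exp(x) L_n^alpha(-x)] and on [L_n^alpha(x)],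
    respectively. *)
Definition seed_eigen i : K :=
  (if (lab i).1 then alpha + 1 + (lab i).2%:R else - (lab i).2%:R)%:K.

Lemma tau_seed_row i j : tau (seed_row alpha (lab i) j)
  = iter j (twist dr (seed_type i)) (seed_fun i).
Proof.
rewrite /seed_type /seed_fun /seed_row /seed_poly.
case: (lab i) => [[] n] /=.
  rewrite -[lagrowN _ _ _]/(laguerre_neg (alpha + j%:R) n).
  elim: j => [|j IH]; first by rewrite mulr0n addr0.
  rewrite iterS -IH -natr1 addrA laguerre_neg_shift // rmorphD /=.
  by rewrite /twist dr_tauE polyC1 rmorph1 mul1r.
rewrite /lagrow; elim: j => // j IH.
by rewrite iterS -IH derivnS /twist dr_tauE polyC0 rmorph0 mul0r addr0.
Qed.

Lemma seed_fun_eigen i :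
  laguerre_op dr seed_type seed_fun (tau 'X) ((alpha + 1)%:K - tau 'X) 0
    (seed_type i) (seed_fun i) = seed_eigen i * seed_fun i.
Proof.
rewrite /laguerre_op /potential big_ord0 (der0 derD).
rewrite /twist derD derM !dr_constE /seed_type /seed_fun /seed_eigen /seed_poly.
case: (lab i) => [[] n] /=; rewrite !dr_tauE.
  rewrite polyC1 rmorph1 [X in _ = tau X * _]polyCD [X in _ = X * _]rmorphD.
  have := congr1 tau (laguerre_neg_ode charR0 alpha n).
  rewrite -mul_polyC !(rmorphD, rmorphM) /= => E.
  by rewrite [RHS]mulrDl -E; ring.
have := congr1 tau (laguerre_ode charR0 alpha n).
rewrite -mul_polyC !(rmorphD, rmorphN, rmorphM, rmorph0) /= => E.
by apply/eqP; rewrite -subr_eq0 -[X in _ == X]E; apply/eqP; ring.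
Qed.

Local Notation seed := (seed dr seed_type seed_fun).

Lemma tau_detrows rows n : size rows = n ->
  (forall i, (i < n)%N -> nth (fun=> 0) rows i = seed_row alpha (lab i)) ->
  (forall i, (i < n.-1)%N -> seed i != 0) ->
  tau (detrows rows) = \prod_(i < n) seed i.
Proof.
move=> sr rowsE s0; rewrite (detrowsE sr) -det_map_mx.
rewrite -(det_wronskian derD derM s0); congr (\det _).
by apply/matrixP => i j; rewrite !mxE rowsE // tau_seed_row.
Qed.

End Seeds.

Lemma eq_seed lab lab' n i : (i < n)%N ->
  (forall j, (j < n)%N -> lab j = lab' j) ->
  seed dr (seed_type lab) (seed_fun lab) i
  = seed dr (seed_type lab') (seed_fun lab') i.
Proof.
move=> i_n E; rewrite /seed /seed_type /seed_fun E //.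
by apply: eq_crum => j ji; rewrite E ?(ltn_trans ji).
Qed.

Lemma tau_detrows_cons lab rows n q : size rows = n ->
  (forall i, (i < n)%N -> nth (fun=> 0) rows i = seed_row alpha (lab i)) ->
  (forall i, (i < n)%N -> seed dr (seed_type lab) (seed_fun lab) i != 0) ->
  tau (detrows (lagrow alpha q :: rows))
  = (-1) ^+ n * (tau (detrows rows)
    * crum dr (seed_type lab) (seed_fun lab) n 0 (tau (laguerre alpha q))).
Proof.
move=> sr rowsE s0.
(* The new Laguerre polynomial becomes seed [n], of exponential type 0. *)
pose lab' i := if (i < n)%N then lab i else (false, q).
have labE j : (j < n)%N -> lab' j = lab j by rewrite /lab' => ->.
have seedE i : (i < n)%N -> seed dr (seed_type lab') (seed_fun lab') i
                        = seed dr (seed_type lab) (seed_fun lab) i.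
  by move=> i_n; apply: eq_seed i_n labE.
rewrite detrows_cons sr rmorphM rmorph_sign; congr (_ * _).
rewrite (@tau_detrows lab' _ n.+1) ?size_rcons ?sr //; last 2 first.
- move=> i; rewrite ltnS nth_rcons sr /lab'.
  by case: ltngtP => [i_n|//|_] _ //; rewrite rowsE.
- by move=> i i_n; rewrite seedE // s0.
rewrite big_ord_recr /=; congr (_ * _).
  rewrite (tau_detrows sr rowsE) => [|i i_n]; last first.
    by apply: s0; apply: leq_trans i_n (leq_pred _).
  by apply: eq_bigr => i _; exact: seedE.
have -> : 0 = seed_type lab' n by rewrite /seed_type /lab' ltnn polyC0 rmorph0.
have -> : tau (laguerre alpha q) = seed_fun lab' n.
  by rewrite /seed_fun /lab' ltnn.
by rewrite /seed; apply: eq_crum => i i_n; rewrite /seed_type /seed_fun labE.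
Qed.

Variable F : {fset nat} * {fset nat}.
Hypothesis F1_gt0 : forall f, f \in F.1 -> (0 < f)%N.
Hypothesis F2_gt0 : forall f, f \in F.2 -> (0 < f)%N.
Hypothesis F2_neq0 : F.2 <> fset0.

Let F' := dropmax F.
Let k := cardH F'.
Let lab i := nth (false, 0%N) (labels F) i.
Local Notation g := (seed_type lab).
Local Notation f := (seed_fun lab).
Local Notation sd := (seed dr g f).
Let O := tau (Omega alpha F).
Let P := tau (Omega alpha F').

Lemma cardH_dropmax : cardH F = k.+1.
Proof. by rewrite /k -!size_labels (labels_dropmax F2_neq0) size_rcons. Qed.

Lemma labels_seed_neq0 i : (i <= k)%N -> sd i != 0.
Proof.
rewrite -ltnS -cardH_dropmax.
pose s i := ((lab i).1%:R : R, seed_poly alpha (lab i)).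
have sz j : size (s j).2 = (lab j).2.+1.
  rewrite /= /seed_poly; case: ifP => _.
    exact: (size_laguerre_neg charR0).
  exact: (size_laguerre charR0).
apply: (@seed_tau_neq0 R K tau dr charR0 tau_inj tau_frac dr_quot s).
  by move=> j _; rewrite -size_poly_eq0 sz.
move=> a b ab E; rewrite !sz ltnS; apply: labels_increasing.
  by rewrite size_labels.
(* The types are compared in [R], where [1 != 0] gives back equality of the booleans. *)
move: E; rewrite /= -/(lab a) -/(lab b); case: (lab a).1 (lab b).1 => [] [] // /eqP.
  by rewrite oner_eq0.
by rewrite eq_sym oner_eq0.
Qed.

Lemma rows_lab i : (i < k.+1)%N ->
  nth (fun=> 0) (Hrows alpha F) i = seed_row alpha (lab i).
Proof.
move=> ik; rewrite Hrows_labels (nth_map (false, 0%N)) //.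
by rewrite size_labels cardH_dropmax.
Qed.

Lemma rows_dropmax_lab i : (i < k)%N ->
  nth (fun=> 0) (Hrows alpha F') i = seed_row alpha (lab i).
Proof.
move=> ik; rewrite Hrows_labels (nth_map (false, 0%N)) ?size_labels //.
by rewrite /lab (labels_dropmax F2_neq0) nth_rcons size_labels ik.
Qed.

Lemma size_Hrows H : size (Hrows alpha H) = cardH H.
Proof. by rewrite Hrows_labels size_map size_labels. Qed.

Lemma tau_Omega : O = \prod_(i < k.+1) sd i.
Proof.
apply: tau_detrows; rewrite ?size_Hrows ?cardH_dropmax //; first exact: rows_lab.
by move=> i /= /ltnW; exact: labels_seed_neq0.
Qed.

Lemma tau_Omega_dropmax : P = \prod_(i < k) sd i.
Proof.
apply: tau_detrows; rewrite ?size_Hrows //; first exact: rows_dropmax_lab.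
move=> i /= ik; apply: labels_seed_neq0.
by rewrite ltnW // (leq_trans ik) // leq_pred.
Qed.

Lemma P_neq0 : P != 0.
Proof.
rewrite tau_Omega_dropmax; apply/prodf_neq0 => i _.
by apply: labels_seed_neq0; exact: ltnW.
Qed.

Lemma O_neq0 : O != 0.
Proof.
rewrite tau_Omega; apply/prodf_neq0 => i _.
by apply: labels_seed_neq0; rewrite -ltnS.
Qed.

Lemma seed_last : sd k = O / P.
Proof.
rewrite tau_Omega big_ord_recr /= -tau_Omega_dropmax mulrC mulKf //.
exact: P_neq0.
Qed.

Lemma lab_last : lab k = (true, maxF2 F).
Proof. by rewrite /lab (labels_dropmax F2_neq0) nth_rcons size_labels ltnn eqxx. Qed.

Lemma logder_last : logder dr g f k = 1 + dr O / O - dr P / P.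
Proof.
have O0 := O_neq0; have P0 := P_neq0.
rewrite /logder /twist seed_last (der_div derM) //.
have -> : g k = 1 by rewrite /seed_type lab_last polyC1 rmorph1.
by field; rewrite O0 P0.
Qed.

(** The exponential factors contribute 1 for each seed of [F'.2]; the remaining terms add up to the
    logarithmic derivative of the product [P]. *)
Lemma sum_logder :
  \sum_(i < k) logder dr g f i = #|` F'.2|%:R + dr P / P.
Proof.
have s0 i : (i < k)%N -> sd i != 0 by move/ltnW; exact: labels_seed_neq0.
transitivity (\sum_(i < k) (g i + dr (sd i) / sd i)).
  by apply: eq_bigr => i _; rewrite /logder /twist mulrDl mulfK ?s0 // addrC.
rewrite big_split /= (der_logprod derM s0) -tau_Omega_dropmax; congr (_ + _).
transitivity (\sum_(l <- labels F') l.1%:R : K).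
  rewrite (big_nth (false, 0%N)) big_mkord size_labels; apply: eq_bigr => i _.
  rewrite /seed_type /lab (labels_dropmax F2_neq0) nth_rcons size_labels ltn_ord.
  by rewrite polyC_natr rmorph_nat.
rewrite /labels big_cat !big_map /= big1 // add0r.
by rewrite big_const_seq count_predT size_sort iter_addr addr0.
Qed.

(** [opD] over the abstract field, as [frac_opA] and [frac_opB] are for [opA] and [opB]; with
    [K := {fraction {poly R}}] they are convertible to the originals. *)
Definition frac_opD H (r : K) : K :=
  let O := tau (Omega alpha H) in
  let O' := tau (Omega alpha H)^`() in
  let O'' := tau (Omega alpha H)^`(2) in
  let k := cardH H in
  let h1 := (alpha + k%:R + 1)%:K - tau 'X - 2%:R * tau 'X * (O' / O) in
  let h0 := (- #|` H.1|%:R - (uH H)%:R)%:K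
            + (tau 'X - (alpha + k%:R)%:K) * (O' / O) + tau 'X * (O'' / O) in
  tau 'X * dr (dr r) + h1 * dr r + h0 * r.

Definition frac_opA (r : K) : K :=
  let O := Omega alpha F in
  let P := Omega alpha (dropmax F) in
  - (tau O / tau P) * dr r + (tau (O^`() + O) / tau P) * r.

Definition frac_opB (r : K) : K :=
  let O := Omega alpha F in
  let P := Omega alpha (dropmax F) in
  (- tau 'X * tau P / tau O) * dr r
  + ((tau 'X * tau P^`() - (alpha + (cardH F)%:R)%:K * tau P) / tau O) * r.

(** Let [y] be the Laguerre polynomial of degree [n - uH F] after [k] Darboux steps. The two
    determinants are [(-1)^k P y] and [(-1)^(k+1) O (y' - v y)], where [v] is [logder k], and
    [frac_opA] sends the first to the second. *)
Lemma xlaguerre_opA n : (uH F <= n)%N ->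
  tau (xlaguerre alpha F n)
  = frac_opA (tau (xlaguerre alpha F' (n + #|` F.2| - 1 - maxF2 F))).
Proof.
move=> un; have O0 := O_neq0; have P0 := P_neq0.
have -> : xlaguerre alpha F' (n + #|` F.2| - 1 - maxF2 F)
    = detrows (lagrow alpha (n - uH F) :: Hrows alpha F').
  rewrite /xlaguerre; congr (detrows (lagrow _ _ :: _)).
  have := uH_dropmax F1_gt0 F2_gt0 F2_neq0.
  by rewrite (perm_size (perm_dropmax F2_neq0)) /= -/F'; lia.
rewrite /xlaguerre (tau_detrows_cons _ (n := k.+1) (lab := lab)); last 3 first.
- by rewrite size_Hrows cardH_dropmax.
- exact: rows_lab.
- by move=> i ik; exact: labels_seed_neq0.
rewrite /frac_opA (tau_detrows_cons _ (n := k) (lab := lab)); last 3 first.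
- by rewrite size_Hrows.
- exact: rows_dropmax_lab.
- by move=> i /ltnW ik; exact: labels_seed_neq0.
rewrite -/(Omega alpha F) -/(Omega alpha F') -/O -/P crumS logder_last.
have sgn0 : dr ((-1) ^+ k) = 0.
  by rewrite -(rmorph_sign tau) -(rmorphN1 polyC) -rmorphXn dr_constE.
rewrite derM sgn0 derM rmorphD /= -dr_tauE -/O /twist exprS.
by move: (crum _ _ _ _ _ _) ((-1) ^+ k) => z e; field; rewrite O0 P0.
Qed.

Lemma polyC_natK (n : nat) : n%:R%:K = n%:R.
Proof. by rewrite polyC_natr rmorph_nat. Qed.

Let constE := (polyCB, polyCN, polyCD, rmorphB tau, rmorphN tau, rmorphD tau,
  polyC1, rmorph1 tau, polyC_natK).

Let k1 : K := #|` F.1|%:R.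
Let k2 : K := #|` F'.2|%:R.

(** The Riccati equation of the last seed, whose label [(true, maxF2 F)] determines the eigenvalue
    on the right. *)
Lemma riccati_last :
  tau 'X * (dr (1 + dr O / O - dr P / P) + (1 + dr O / O - dr P / P) ^+ 2)
  + (alpha%:K + 1 - tau 'X + (k1 + k2)) * (1 + dr O / O - dr P / P)
  + (- (k1 + k2) + (k2 + dr P / P) + 2%:R * tau 'X * dr (k2 + dr P / P))
  = alpha%:K + 1 + (maxF2 F)%:R.
Proof.
have Db : dr ((alpha + 1)%:K - tau 'X) = -1.
  by rewrite (derB derD) dr_constE dr_tauE derivX rmorph1 sub0r.
have Dx : dr (tau 'X) = 1 by rewrite dr_tauE derivX rmorph1.
have := @riccati K dr derD derM g f _ _ (seed_eigen lab) Dx Db.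
move/(_ (fun i => dr_constE _) (fun i => dr_constE _) (seed_fun_eigen lab) k).
move/(_ labels_seed_neq0); rewrite /potential sum_logder logder_last.
have -> : k%:R = k1 + k2 by rewrite /k /cardH natrD.
by rewrite /seed_eigen lab_last /= !constE.
Qed.

Lemma dr_nat (n : nat) : dr n%:R = 0.
Proof. exact: der_nat derD derM n. Qed.

Lemma natr_cardH_dropmax : (cardH F')%:R = k1 + k2.
Proof. by rewrite /cardH natrD. Qed.

Lemma natr_cardH : (cardH F)%:R = k1 + k2 + 1.
Proof. by rewrite cardH_dropmax -natr1 natr_cardH_dropmax. Qed.

Lemma opD_dropmax_BA r : frac_opD F' r
  = frac_opB (frac_opA r) + (alpha + (maxF2 F)%:R - (uH F')%:R + 1)%:K * r.
Proof.
have := factor_BA derD derM (dr_nat _) O_neq0 P_neq0 riccati_last (uH F')%:R r.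
rewrite /frac_opD /frac_opB /frac_opA !derivnS derivn0 !constE -!dr_tauE -/O -/P.
rewrite natr_cardH natr_cardH_dropmax -/k1 => E.
by rewrite E; congr (_ + _ * _); ring.
Qed.

Lemma opD_AB r : frac_opD F r
  = frac_opA (frac_opB r) + (alpha + (maxF2 F)%:R - (uH F)%:R + 1)%:K * r.
Proof.
have Dx : dr (tau 'X) = 1 by rewrite dr_tauE derivX rmorph1.
have := factor_AB derD derM Dx (dr_constE _) (dr_nat _) (dr_nat _) O_neq0 P_neq0
  riccati_last (uH F)%:R r.
rewrite /frac_opD /frac_opB /frac_opA !derivnS derivn0 !constE -!dr_tauE -/O -/P.
rewrite natr_cardH -/k1 => E.
by rewrite E; congr (_ + _ * _); ring.
Qed.

End Factorization.

Lemma tofrac_injective (T : idomainType) : injective (@FracField.tofrac T).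
Proof. by move=> p q /eqP; rewrite tofrac_eq => /eqP. Qed.

Lemma ratfrac_repr (R : fieldType) (r : {fraction {poly R}}) :
  exists n d : {poly R}, d != 0 /\ r = n%:F / d%:F.
Proof.
exists \n_(repr r), \d_(repr r); split; first exact: denom_ratioP.
exact: fraction_repr.
Qed.

Theorem lemma5p4 (R : realType) (alpha : R) (F : {fset nat} * {fset nat})
  (halpha : forall m : nat, alpha <> - m.+1%:R)
  (hF1 : forall f : nat, f \in F.1 -> (0 < f)%N)
  (hF2 : forall f : nat, f \in F.2 -> (0 < f)%N)
  (hF2_neq0 : F.2 <> fset0) :
  let F' := dropmax F in
  let fmax := maxF2 F in
  [/\ forall n : nat, n \in sigmaH F ->
        (xlaguerre alpha F n)%:F
        = opA alpha F (xlaguerre alpha F' (n + #|` F.2| - 1 - fmax))%:F,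
      forall r : {fraction {poly R}},
        opD alpha F' r
        = opB alpha F (opA alpha F r)
          + (alpha + fmax%:R - (uH F')%:R + 1)%:P%:F * r
    & forall r : {fraction {poly R}},
        opD alpha F r
        = opA alpha F (opB alpha F r)
          + (alpha + fmax%:R - (uH F)%:R + 1)%:P%:F * r].
Proof.
move=> F' fmax.
have char0 (n : nat) : n.+1%:R != 0 :> R by rewrite pnatr_eq0.
split.
- move=> n /andP[un _].
  exact: (@xlaguerre_opA R _ (@FracField.tofrac {poly R}) (@ratder R) char0
    (@tofrac_injective _) (@ratfrac_repr R) (@ratder_quot R) alpha F
    hF1 hF2 hF2_neq0 n un).
- exact: (@opD_dropmax_BA R _ (@FracField.tofrac {poly R}) (@ratder R) char0
    (@tofrac_injective _) (@ratfrac_repr R) (@ratder_quot R) alpha F hF2_neq0).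
- exact: (@opD_AB R _ (@FracField.tofrac {poly R}) (@ratder R) char0
    (@tofrac_injective _) (@ratfrac_repr R) (@ratder_quot R) alpha F hF2_neq0).
Qed.
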